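(* Let $G$ be a locally compact group and let $(A,\mu)$ be a partially crossed topological $G-R$-bimodule such that $G$ acts trivially on $A$ and $R$. (1) If $R$ is a $k$-group and $A$ is compact without small subgroups, then $H^{1}(G,(A,\mu))$ is a $k$-space. (2) If $G$ is compactly generated, $R$ is a $k$-group and $A$ is locally compact without small subgroups, then $H^{1}(G,(A,\mu))$ is a $k$-space. (3) If $G$ is compact, $A$ has no small subgroups and $R$ is discrete, then $H^{1}(G,(A,\mu))$ is discrete. (4) If $G$ and $R$ are finite discrete and $A$ is compact without small subgroups, then $H^{1}(G,(A,\mu))$ is a finite discrete space.
   Context: All topological groups ($G$, $R$, $A$) are assumed Hausdorff (not necessarily abelian). A topological $G$-module is a topological group $A$ with a continuous left action of the topological group $G$ on $A$ by group automorphisms, $(g,a)\mapsto {}^{g}a$. Every topological group acts on itself by conjugation: ${}^{g}h=ghg^{-1}$. If several groups act on $A$, a word acts by successive actions, e.g. ${}^{grg^{-1}}a={}^{g}({}^{r}({}^{g^{-1}}a))$. A precrossed topological $R$-module is a pair $(A,\mu)$ where $A$ is a topological $R$-module and $\mu:A\to R$ is a continuous homomorphism with $\mu({}^{r}a)={}^{r}\mu(a)=r\mu(a)r^{-1}$ for all $r\in R$, $a\in A$. It is a partially crossed topological $R$-module if ${}^{\mu(a)}b={}^{a}b=aba^{-1}$ for all $b\in A$ and all $a\in A$ with $\mu(a)\in[R,R]$ (the commutator subgroup). A precrossed topological $G-R$-bimodule is a precrossed topological $R$-module $(A,\mu)$ such that (1) $G$ acts continuously (by automorphisms) on $R$ and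 on $A$; (2) $\mu$ is a $G$-homomorphism, i.e. $\mu({}^{g}a)={}^{g}\mu(a)$; (3) ${}^{({}^{g}r)}a={}^{grg^{-1}}a$ for all $g\in G$, $r\in R$, $a\in A$. It is a partially crossed topological $G-R$-bimodule if moreover $(A,\mu)$ is a partially crossed topological $R$-module. A crossed homomorphism is a map $\alpha:G\to A$ with $\alpha(gh)=\alpha(g)\,{}^{g}\alpha(h)$ for all $g,h\in G$. $Der_{c}(G,(A,\mu))$ is the set of pairs $(\alpha,r)$ with $\alpha:G\to A$ a continuous crossed homomorphism and $r\in R$ such that $\mu(\alpha(g))=r\,({}^{g}r)^{-1}$ for all $g\in G$. It carries the subspace topology from $\mathcal{C}_{k}(G,A)\times R$, where $\mathcal{C}_{k}(G,A)$ is the set of continuous maps $G\to A$ with the compact-open topology. $H^{0}(G,R)=\{r\in R: {}^{g}r=r\ \forall g\in G\}$. On $Der_{c}(G,(A,\mu))$ define $(\alpha,r)\sim(\beta,s)$ iff there is $a\in A$ with $\beta(g)=a^{-1}\alpha(g)\,{}^{g}a$ for all $g\in G$ and $s=\mu(a)^{-1}r$ mod $H^{0}(G,R)$ (i.e. $s\in\mu(a)^{-1}rH^{0}(G,R)$). This is an equivalence relation, and $H^{1}(G,(A,\mu))$ is the quotient set $Der_{c}(G,(A,\mu))/\sim$ with the quotient topology. A topological group has no small subgroups (is without small subgroups) if some neighborhood of the identity contains no nontrivial subgroup. It is compactly generated if it is generated by a compact subset. A topological space $X$ is a $k$-space if every subset of $X$ whose intersection with every compact $K\subset X$ is relatively open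 in $K$ is open in $X$. A $k$-group is a topological group that is a $k$-space. *)

(* Defs.v *)
From HB Require Import structures.
From mathcomp Require Import all_boot all_classical topology.

Set Implicit Arguments.
Unset Strict Implicit.
Unset Printing Implicit Defensive.

Local Open Scope classical_set_scope.
Local Open Scope quotient_scope.
Local Open Scope group_scope.

HB.mixin Record isTopologicalGroup G of Topological G & Group G := {
  mulg_continuous : continuous (fun x : G * G => x.1 * x.2);
  invg_continuous : continuous (fun x : G => x^-1)
}.

(* Not Hausdorff by definition: separation is a hypothesis of the theorem. *)
#[short(type="topGroupType")]
HB.structure Definition TopologicalGroup :=
  {G of Topological G & Group G & isTopologicalGroup G}.

Definition is_subgroup (G : groupType) (H : set G) : Prop := group_closed [in H].

Definition generated_subgroup (G : groupType) (S : set G) : set G :=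
  smallest (@is_subgroup G) S.

Definition commutator_subgroup (G : groupType) : set G :=
  generated_subgroup [set z | exists x y : G, z = [~ x, y]].

Definition no_small_subgroups (G : topGroupType) : Prop :=
  exists2 U : set G, nbhs 1 U &
    forall H : set G, is_subgroup H -> H `<=` U -> H = [set 1].

Definition compactly_generated (G : topGroupType) : Prop :=
  exists2 K : set G, compact K & generated_subgroup K = [set: G].

Definition k_space (X : topologicalType) : Prop :=
  forall U : set X,
    (forall K : set X, compact K ->
       exists2 V : set X, open V & U `&` K = V `&` K) ->
    open U.

Definition k_group (G : topGroupType) : Prop := k_space G.

Definition is_discrete (X : topologicalType) : Prop := forall U : set X, open U.

Record topological_module (G A : topGroupType) (act : G -> A -> A) : Prop := {
  act_continuous : continuous (fun x : G * A => act x.1 x.2);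
  act1g : forall a, act 1 a = a;
  actMg : forall g h a, act (g * h) a = act g (act h a);
  actgM : forall g a b, act g (a * b) = act g a * act g b
}.

Record precrossed_module (R A : topGroupType)
    (actRA : R -> A -> A) (mu : A -> R) : Prop := {
  precrossed_topmod : topological_module actRA;
  mu_continuous : continuous mu;
  muM : forall a b, mu (a * b) = mu a * mu b;
  mu_act : forall r a, mu (actRA r a) = r * mu a * r^-1
}.

Record partially_crossed_module (R A : topGroupType)
    (actRA : R -> A -> A) (mu : A -> R) : Prop := {
  partially_crossed_precrossed : precrossed_module actRA mu;
  partially_crossedP : forall a b : A,
    @commutator_subgroup R (mu a) -> actRA (mu a) b = a * b * a^-1
}.

Record precrossed_bimodule (G R A : topGroupType) (actGR : G -> R -> R)
    (actGA : G -> A -> A) (actRA : R -> A -> A) (mu : A -> R) : Prop := {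
  bimod_precrossed : precrossed_module actRA mu;
  bimod_topmodR : topological_module actGR;
  bimod_topmodA : topological_module actGA;
  bimod_mu_act : forall g a, mu (actGA g a) = actGR g (mu a);
  bimod_act_compat : forall g r a,
    actRA (actGR g r) a = actGA g (actRA r (actGA g^-1 a))
}.

Record partially_crossed_bimodule (G R A : topGroupType) (actGR : G -> R -> R)
    (actGA : G -> A -> A) (actRA : R -> A -> A) (mu : A -> R) : Prop := {
  pc_bimod_precrossed :> precrossed_bimodule actGR actGA actRA mu;
  pc_bimod_partially_crossed : partially_crossed_module actRA mu
}.

(* The library topologizes the type of all maps; Ck is its subspace of the
   continuous ones. *)
Definition Ck (X Y : topologicalType) : Type :=
  set_type [set f : {compact-open, X -> Y} | continuous (f : X -> Y)].
HB.instance Definition _ (X Y : topologicalType) := Topological.on (Ck X Y).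

Definition Ck_fun (X Y : topologicalType) (f : Ck X Y) : X -> Y := set_val f.
Coercion Ck_fun : Ck >-> Funclass.

Section Cohomology.
Variables (G R A : topGroupType).
Variables (actGR : G -> R -> R) (actGA : G -> A -> A) (actRA : R -> A -> A).
Variable mu : A -> R.

Definition crossed_hom (alpha : G -> A) : Prop :=
  forall g h, alpha (g * h) = alpha g * actGA g (alpha h).

Definition der_set : set (Ck G A * R) :=
  [set x : Ck G A * R |
    crossed_hom x.1 /\ forall g, mu (x.1 g) = x.2 / actGR g x.2].

Definition Der_c : Type := set_type der_set.
HB.instance Definition _ := Topological.on Der_c.

Definition der_alpha (x : Der_c) : Ck G A := (set_val x).1.
Definition der_r (x : Der_c) : R := (set_val x).2.

Definition H0 : set R := [set r | forall g, actGR g r = r].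

Definition der_sim (x y : Der_c) : Prop :=
  exists a : A,
    (forall g, der_alpha y g = a^-1 * der_alpha x g * actGA g a) /\
    exists2 h, H0 h & der_r y = (mu a)^-1 * der_r x * h.

Section Quotient.
Hypothesis M : precrossed_bimodule actGR actGA actRA mu.

Let actGA1 g : actGA g 1 = 1.
Proof.
have e := actgM (bimod_topmodA M) g 1 1.
by apply: (@mulgI A (actGA g 1)); rewrite -e !mulg1.
Qed.

Let actGAV g a : actGA g a^-1 = (actGA g a)^-1.
Proof.
apply: (@mulgI A (actGA g a)).
by rewrite -(actgM (bimod_topmodA M)) !mulgV actGA1.
Qed.

Let mu1 : mu 1 = 1.
Proof.
have e := muM (bimod_precrossed M) 1 1.
by apply: (@mulgI R (mu 1)); rewrite -e !mulg1.
Qed.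

Let muV a : mu a^-1 = (mu a)^-1.
Proof.
apply: (@mulgI R (mu a)).
by rewrite -(muM (bimod_precrossed M)) !mulgV mu1.
Qed.

Let actGR1 g : actGR g 1 = 1.
Proof.
have e := actgM (bimod_topmodR M) g 1 1.
by apply: (@mulgI R (actGR g 1)); rewrite -e !mulg1.
Qed.

Let actGRV g r : actGR g r^-1 = (actGR g r)^-1.
Proof.
apply: (@mulgI R (actGR g r)).
by rewrite -(actgM (bimod_topmodR M)) !mulgV actGR1.
Qed.

Lemma der_sim_refl x : der_sim x x.
Proof.
exists 1; split=> [g|]; first by rewrite invg1 mul1g actGA1 mulg1.
by exists 1 => [g|]; rewrite ?actGR1 // mu1 invg1 mul1g mulg1.
Qed.

Lemma der_sim_sym x y : der_sim x y -> der_sim y x.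
Proof.
move=> [a [ea [h h0 eh]]]; exists a^-1; split=> [g|].
  by rewrite ea invgK actGAV !mulgA mulgV mul1g mulgK.
exists h^-1 => [g|]; first by rewrite actGRV h0.
by rewrite eh muV invgK !mulgA mulgV mul1g mulgK.
Qed.

Lemma der_sim_trans x y z : der_sim x y -> der_sim y z -> der_sim x z.
Proof.
move=> [a [ea [h h0 eh]]] [b [eb [k k0 ek]]]; exists (a * b); split=> [g|].
  by rewrite eb ea (actgM (bimod_topmodA M)) invgM !mulgA.
exists (h * k) => [g|]; first by rewrite (actgM (bimod_topmodR M)) h0 k0.
by rewrite ek eh (muM (bimod_precrossed M)) invgM !mulgA.
Qed.

Definition der_simb (x y : Der_c) : bool := `[< der_sim x y >].

Lemma der_simb_equiv : equiv_class_of der_simb.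
Proof.
split=> [x|x y|y x z].
- exact/asboolP/der_sim_refl.
- by apply/asboolP/asboolP; exact: der_sim_sym.
- by move=> /asboolP xy /asboolP yz; exact/asboolP/(der_sim_trans xy yz).
Qed.

Definition der_equiv : equiv_rel Der_c := EquivRelPack der_simb_equiv.

Definition H1 : topologicalType := quotient_topology {eq_quot der_equiv}.

End Quotient.
End Cohomology.

(* Main.v *)
Require Import Defs.
From mathcomp Require Import all_boot all_classical topology.

(** When [G] acts trivially on [A] and [R], the cohomology set is a space of
    homomorphisms. A crossed homomorphism is then a homomorphism, and the
    condition on a pair [(alpha, r)] becomes [mu (alpha g) = 1], so that
    derivations are the pairs of a continuous homomorphism [G -> Ker mu] and an
    arbitrary [r]. Since [1] lies in the commutator subgroup of [R], the
    partially crossed condition makes [Ker mu] central in [A]: conjugating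
    [alpha] by an element of [A] does nothing. On the other side [H0] is all of
    [R], so [r] can be changed at will. Hence two derivations are equivalent
    exactly when they have the same [alpha] ([der_simE]), and the topology of
    [H1] is that of [Hom_c(G, Ker mu)] in the compact-open topology; the two
    directions of this comparison that matter are [cls_nbhs] and [cls_compact].

    It remains to study continuous homomorphisms from a locally compact group
    into a closed central subset of a group without small subgroups.
    If [V] is a small compact neighborhood of [1] in [A], then an element whose
    first [n] powers stay in [V] has to be very close to [1], with [n] governed
    by the required closeness ([nss_powers]). Let [K] be a compact neighborhood
    of [1] in [G], and [f] a homomorphism. For a homomorphism [chi] which is
    [V]-close to [f] on [K], the quotient [f^-1 chi] is a homomorphism because
    values are central, and it maps to [V] all [x] whose first [n] powers are
    in [K]. So the homomorphisms [V]-close to [f] on [K] form an equicontinuous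
    set; it is a neighborhood of [f] ([uniformly_near_nbhs]), and by Tychonoff
    and an Ascoli argument ([equicontinuous_morphisms_compact]) it is compact
    as soon as its values at each point of [G] stay in a compact set. This is
    clear if [A] is compact, and it propagates from a compact generating subset
    of [G] to the whole of [G] ([near_morphisms_bounded]). Thus, for
    [A] compact or for [G] compactly generated and [A] locally compact, every
    point of [H1] has a compact neighborhood, which implies the k-space
    property.

    If [G] is compact, take [K = G]: the values of [f^-1 chi] form a subgroup
    contained in [V], so [chi = f] ([uniformly_near_eq]) and [H1] is discrete.
    If [G] is finite discrete and [A] compact, all homomorphisms together form a compact
    set, and a compact discrete space is finite. *)

Set Implicit Arguments.
Unset Strict Implicit.
Unset Printing Implicit Defensive.

Local Open Scope classical_set_scope.

(** * General topology *)

Lemma k_space_compact_nbhs (X : topologicalType) :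
  (forall x : X, exists2 K : set X, compact K & nbhs x K) -> k_space X.
Proof.
move=> lcX U Uk; rewrite openE => x Ux.
have [K cK nK] := lcX x; have [V oV UKVK] := Uk K cK.
have : (U `&` K) x by split => //; exact: nbhs_singleton.
rewrite UKVK => -[Vx _].
have nVK : nbhs x (V `&` K) by apply: filterI => //; exact: open_nbhs_nbhs.
by apply: filterS nVK; rewrite -UKVK; exact: subIsetl.
Qed.

(** In an infinite discrete space the filter of cofinite sets has no cluster
    point. *)
Lemma discrete_compact_finite (X : topologicalType) :
  is_discrete X -> compact [set: X] -> finite_set [set: X].
Proof.
move=> dX cX; apply: contrapT => infX.
pose F := filter_from (@finite_set X) (fun S => ~` S).
have FF : ProperFilter F.
  apply: filter_from_proper.
    apply: filter_from_filter; first by exists set0; exact: finite_set0.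
    by move=> S T fS fT; exists (S `|` T); rewrite ?finite_setU ?setCU.
  move=> S fS; apply/set0P/eqP => S0; apply: infX.
  by rewrite -(setCK [set: X]) setCT -S0 setCK.
have [p [_ clp]] := cX F FF filterT.
have [//||q [npq pq]] := clp (~` [set p]) [set p].
- by exists [set p]; first exact: finite_set1.
- by apply: open_nbhs_nbhs; split => //; exact: dX.
- exact: npq.
Qed.

(** Compactness of subspaces, in the form needed for the nested subtypes out of
    which derivations are built. *)
Lemma compact_initial (S : choiceType) (T : topologicalType) (f : S -> T)
    (C : set T) : compact C -> C `<=` range f ->
  compact (f @^-1` C : set (initial_topology f)).
Proof.
move=> cC Cf F FF FC.
have [_ [/[dup]/Cf[s _ <-] Cfs clFs]] := cC (f @ F) _ FC.
exists s; split => // A B FA [_ [[B' oB' <-] B's] B'B].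
have FfA : (f @ F) (f @` A).
  suff : F (f @^-1` (f @` A)) by [].
  by apply: filterS FA; exact: preimage_image.
have [_ [[a Aa <-] B'a]] := clFs _ B' FfA (open_nbhs_nbhs (conj oB' B's)).
by exists a; split => //; exact: B'B.
Qed.

(** * Topological groups *)

Section TopologicalGroups.
Local Open Scope group_scope.
Variable A : topGroupType.
Implicit Types (a b : A) (S T U V : set A).

Lemma nbhs_mulg a b U : nbhs (a * b) U ->
  exists V W : set A, [/\ nbhs a V, nbhs b W & forall x y, V x -> W y -> U (x * y)].
Proof.
move=> /(@mulg_continuous A (a, b))[[V W] /= [nV nW] sVW].
by exists V, W; split => // x y Vx Wy; apply: (sVW (x, y)).
Qed.

Lemma continuousMg (T : topologicalType) (f g : T -> A) :
  continuous f -> continuous g -> continuous (fun t => f t * g t).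
Proof.
move=> fc gc t U /nbhs_mulg[V [W [/fc nV /gc nW VW]]].
by rewrite /= !nbhs_simpl /= in nV nW *; apply: filterS2 nV nW => s; exact: VW.
Qed.

Lemma continuousVg (T : topologicalType) (f : T -> A) :
  continuous f -> continuous (fun t => (f t)^-1).
Proof. by move=> fc t; exact: continuous_cvg (@invg_continuous A _) (fc t). Qed.

Lemma continuousMlg a : continuous (fun b : A => a * b).
Proof. by apply: continuousMg => b; [exact: cvg_cst|exact: cvg_id]. Qed.

Lemma expg_continuous n : continuous (fun a : A => a ^+ n).
Proof.
elim: n => [|n IH]; first exact: cst_continuous.
rewrite (_ : (fun b => b ^+ n.+1) = fun b => b * b ^+ n).
  by apply: continuousMg => // b; exact: cvg_id.
by apply/funext => b; rewrite expgS.
Qed.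

Lemma nbhs1_sym_sqr U : nbhs 1 U -> exists V : set A,
  [/\ nbhs 1 V, forall a, V a -> V a^-1 & forall a b, V a -> V b -> U (a * b)].
Proof.
move=> nU; have : nbhs (1 * 1 : A) U by rewrite mulg1.
move=> /nbhs_mulg[V [W [nV nW VW]]].
have nX : nbhs 1 (V `&` W) by exact: filterI.
exists [set a | (V `&` W) a /\ (V `&` W) a^-1]; split.
- apply: filterI => //.
  have /(_ (V `&` W)) := @invg_continuous A 1.
  by rewrite invg1; exact.
- by move=> a /= [Xa XVa]; rewrite invgK.
- by move=> a b [[Va _] _] [[_ Wb] _]; exact: VW.
Qed.

Lemma nbhs_translate a U : nbhs 1 U -> nbhs a [set b | U (a^-1 * b)].
Proof. by move=> nU; apply: (continuousMlg (a := a^-1)); rewrite mulVg. Qed.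

(** Regularity: if [V] is symmetric with [V V] inside [U], then the closure of [V]
    is inside [V V]. *)
Lemma closed_nbhs1 U : nbhs 1 U -> exists V, [/\ nbhs 1 V, closed V & V `<=` U].
Proof.
move=> /nbhs1_sym_sqr[V [nV VI VU]]; exists (closure V); split.
- by apply: filterS nV; exact: subset_closure.
- exact: closed_closure.
- move=> a cVa.
  have /cVa[b [Vb /= Vab]] := nbhs_translate a nV.
  by rewrite -(mulg1 a) -(mulgV (a^-1 * b)) !mulgA mulgV mul1g; apply/VU/VI.
Qed.

Lemma nbhs1_small_powers n U : nbhs 1 U ->
  nbhs 1 [set a | forall k, (k <= n)%N -> U (a ^+ k)].
Proof.
move=> nU; elim: n => [|n IH].
  by apply: filterE => a k; rewrite leqn0 => /eqP ->; exact: nbhs_singleton.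
have nUn : nbhs (1 : A) [set a | U (a ^+ n.+1)].
  have /(_ U) := @expg_continuous n.+1 1.
  by rewrite expg1n; exact.
apply: filterS2 IH nUn => a IH Ua k.
by rewrite leq_eqVlt => /predU1P[->|]//; exact: IH.
Qed.

Lemma locally_compact_nbhs1 : locally_compact [set: A] ->
  exists K : set A, [/\ nbhs 1 K, compact K & closed K].
Proof.
move=> /(_ 1 I)[K nK [cK clK]]; exists K; split => //.
by move: nK; rewrite /within /=; apply: filterS => a; exact.
Qed.

Lemma compact_mulg S T : compact S -> compact T ->
  compact [set x.1 * x.2 | x in S `*` T].
Proof.
move=> cS cT; apply: continuous_compact; last exact: compact_setX.
exact/continuous_subspaceT/mulg_continuous.
Qed.

Lemma compact_invg S : compact S -> compact [set a^-1 | a in S].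
Proof.
move=> cS; apply: continuous_compact => //.
exact/continuous_subspaceT/invg_continuous.
Qed.

(** * Groups without small subgroups *)

(** The form in which the absence of small subgroups constrains homomorphisms: it
    is about one element at a time, and a bound on the exponent can be extracted
    from it by compactness. *)
Definition contains_no_powers V : Prop :=
  forall a, (forall k, V (a ^+ k)) -> a = 1.

Lemma nss_compact_nbhs : no_small_subgroups A -> locally_compact [set: A] ->
  exists V : set A, [/\ nbhs 1 V, compact V, closed V & contains_no_powers V].
Proof.
move=> [U nU Usub] /locally_compact_nbhs1[C [nC cC clC]].
have [U' [nU' U'I U'U]] := nbhs1_sym_sqr nU.
have [V [nV clV VU']] := closed_nbhs1 nU'.
exists (C `&` V); split.
- exact: filterI.
- exact: compact_closedI.
- exact: closedI.
(* The powers of [a] are in [U'], which is symmetric with [U' U'] inside [U], so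
   the quotients of two powers form a subgroup inside [U]. *)
- move=> a aV; pose H := [set b | exists m n, b = a ^+ m * (a ^+ n)^-1].
  suff H1 : H = [set 1].
    have : H a by exists 1%N, 0%N; rewrite expg0 invg1 mulg1.
    by rewrite H1.
  have aC m n : commute (a ^+ m) (a ^+ n)^-1.
    exact/commuteV/commuteX2/commute_refl.
  apply: Usub.
    split; first by rewrite inE; exists 0%N, 0%N; rewrite invg1 mulg1.
    move=> _ _ /set_mem[m [n ->]] /set_mem[p [q ->]]; rewrite inE.
    exists (m + q)%N, (p + n)%N.
    by rewrite invgM invgK !expgnDr invgM -!mulgA; congr (_ * _); rewrite !mulgA aC.
  by move=> _ [m [n ->]]; apply: U'U; [|apply: U'I]; apply: VU'; apply aV.
Qed.

(** Each [a <> 1] in [V] has a power outside [V], and so have its neighbors, for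
    the same exponent; by compactness a bounded exponent suffices for all the
    elements of [V] which are not in [U]. *)
Lemma nss_powers V U : compact V -> closed V -> contains_no_powers V ->
    nbhs 1 U ->
  exists n, forall a, (forall k, (k <= n)%N -> V (a ^+ k)) -> U a.
Proof.
move=> /compact_near_coveringP cV clV V1 nU.
pose P n a := (forall k, (k <= n)%N -> V (a ^+ k)) -> U a.
have [a Va|n _ nP] := cV nat \oo P _.
  have [->|a1] := pselect (a = 1).
    by exists (U, setT) => [|[b n] [/= Ub _] _ //]; split => //; exact: filterT.
  have [k Vk] : exists k, ~ V (a ^+ k) by apply/existsNP => /V1.
  exists ((fun b => b ^+ k) @^-1` ~` V, [set n | (k <= n)%N]) => /=.
    split; last by exists k.
    apply: expg_continuous; apply: open_nbhs_nbhs.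
    by split => //; exact: closed_openC.
  by move=> [b n] /= [nVb kn] /(_ k kn).
(* At least one power is needed to know that [a] itself is in [V]. *)
exists n.+1 => a Va; apply: (nP n.+1 (leqnSn n)) => //=.
by rewrite -(expg1 a); exact: Va.
Qed.

End TopologicalGroups.

(** * Compact sets of homomorphisms in the compact-open topology *)

Section FunctionSpace.
Local Open Scope group_scope.
Variables G A : topGroupType.
Implicit Types (f chi : G -> A) (K : set G) (V : set A).

Definition uniformly_near f K V : set (G -> A) :=
  [set chi | forall x, K x -> V ((f x)^-1 * chi x)].

(** Around [x] in [K], the map [f] varies by less than [W'], hence any [chi]
    sending the compact set [K `&` T] into the open set [O] stays close to [f]
    there; finitely many such [T] cover [K]. The set [W'] is closed in order
    that [K `&` T] be compact. *)
Lemma uniformly_near_nbhs f K V : continuous f -> compact K -> nbhs 1 V ->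
  nbhs (f : {compact-open, G -> A}) (uniformly_near f K V).
Proof.
move=> fc cK nV; have [W [nW WI WV]] := nbhs1_sym_sqr nV.
have [W' [nW' clW' W'W]] := closed_nbhs1 (nbhs_interior nW).
have /compact_near_coveringP/near_covering_withinP cK' := cK.
apply: (cK' _ (nbhs (f : {compact-open, G -> A}))
  (fun chi x => V ((f x)^-1 * chi x))).
move=> x Kx.
pose T := [set y | W' ((f x)^-1 * f y)].
pose O := [set a | W° ((f x)^-1 * a)].
have clT : closed T.
  apply: (@closed_comp _ _ (fun y => (f x)^-1 * f y) W') => // y _.
  exact: (continuous_comp (fc y) (@continuousMlg A _ (f y))).
have oO : open O.
  by apply: open_comp; [move=> ? _; exact: continuousMlg|exact: open_interior].
exists (T, [set chi : {compact-open, G -> A} | chi @` (K `&` T) `<=` O]).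
  split => /=.
    by have := fc x _ (nbhs_translate (f x) nW').
  apply: open_nbhs_nbhs; split.
    by apply: compact_open_open => //; exact: compact_closedI.
  by move=> _ [y [_ Ty] <-]; exact: W'W.
move=> [y chi] /= [Ty chiO] Ky.
have /interior_subset Oy : O (chi y) by apply: chiO; exists y.
have /W'W/interior_subset Wy := Ty.
rewrite (_ : _ * _ = ((f x)^-1 * f y)^-1 * ((f x)^-1 * chi y)).
  by apply: WV => //; exact: WI.
by rewrite invgM invgK mulgA mulgK.
Qed.

(** An Ascoli theorem. An ultrafilter on [C] converges pointwise, by Tychonoff;
    for homomorphisms equicontinuity at [1] is equicontinuity everywhere, so
    the convergence is uniform enough to take place in the compact-open
    topology. *)
Lemma equicontinuous_morphisms_compact (C : set (G -> A)) :
    (forall chi, C chi -> {morph chi : x y / x * y}) ->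
    (forall N : set A, nbhs 1 N ->
       exists2 O : set G, nbhs 1 O & forall chi x, C chi -> O x -> N (chi x)) ->
    (forall x, exists2 T : set A, compact T & forall chi, C chi -> T (chi x)) ->
    closed (C : set {ptws G -> A}) ->
  compact (C : set {compact-open, G -> A}).
Proof.
move=> Cmorph equi bnd clC; rewrite compact_ultra => F FU FC.
have /choice[T TP] : forall x : G, exists T : set A,
    compact T /\ forall chi, C chi -> T (chi x).
  by move=> x; have [T] := bnd x; exists T.
have cT := @tychonoff G (fun=> A) T (fun x => (TP x).1).
rewrite compact_ultra in cT.
have [|chi0 [_ Fchi0]] := cT F FU.
  by apply: filterS FC => chi Cchi x; exact: (TP x).2.
have PF : ProperFilter F := ultra_proper.
have Cchi0 : C chi0.
  by apply: clC => B /Fchi0 FB; exact: (filter_ex (filterI FC FB)).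
exists chi0; split => //; apply/compact_open_cvgP => K O cK oO chi0KO.
have /compact_near_coveringP cK' := cK.
suff : \near F, K `<=` (fun chi x => O (chi x)) F.
  by apply: filterS => chi KO _ [x Kx <-]; exact: KO.
apply: (cK' _ F (fun chi x => O (chi x))) => x Kx.
have nO : nbhs (chi0 x * 1) O.
  by rewrite mulg1; apply: open_nbhs_nbhs; split => //; apply: chi0KO; exists x.
have [P [N [nP /equi[Q nQ QN] PN]]] := nbhs_mulg nO.
exists ([set y | Q (x^-1 * y)], [set chi | C chi /\ P (chi x)]).
  split => /=; first exact: nbhs_translate.
  apply: filterI => //.
  by apply: Fchi0; exact: (@proj_continuous G (fun=> A) x chi0).
move=> [y chi] /= [Qy [Cchi Pchi]].
rewrite -(mulVKg x y) Cmorph //; apply: PN => //.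
exact: QN.
Qed.

End FunctionSpace.

(** * Homomorphisms into a closed central subset *)

Section Morphisms.
Local Open Scope group_scope.
Variables G A : topGroupType.
Variable Z : set A.
Implicit Types (f chi : G -> A) (K : set G) (V : set A).

Definition morphisms_into : set (G -> A) :=
  [set chi | {morph chi : x y / x * y} /\ forall x, Z (chi x)].

Lemma morphism_continuous chi : {morph chi : x y / x * y} ->
    (forall N : set A, nbhs 1 N -> nbhs 1 (chi @^-1` N)) -> continuous chi.
Proof.
move=> chiM chi1 x U; rewrite -{1}(mulg1 (chi x)) => /nbhs_mulg[P [N [nP nN PN]]].
apply: filterS (nbhs_translate x (chi1 _ nN)) => y /= Ny.
by rewrite -(mulVKg x y) chiM; apply: PN => //; exact: nbhs_singleton.
Qed.

Lemma morphism1 chi : {morph chi : x y / x * y} -> chi 1 = 1.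
Proof. by move=> chiM; apply: (@mulgI A (chi 1)); rewrite -chiM !mulg1. Qed.

Lemma morphismV chi x : {morph chi : x y / x * y} -> chi x^-1 = (chi x)^-1.
Proof.
by move=> chiM; apply: (@mulgI A (chi x)); rewrite -chiM !mulgV morphism1.
Qed.

Lemma morphismX chi x n : {morph chi : x y / x * y} -> chi (x ^+ n) = chi x ^+ n.
Proof.
move=> chiM; elim: n => [|n IH]; first by rewrite !expg0 morphism1.
by rewrite !expgS chiM IH.
Qed.

Lemma morphisms_into_closed : hausdorff_space A -> closed Z ->
  closed (morphisms_into : set {ptws G -> A}).
Proof.
move=> hausA clZ.
have ev x : continuous (fun chi : {ptws G -> A} => chi x).
  by move=> chi; exact: (@proj_continuous G (fun=> A) x chi).
rewrite (_ : morphisms_into =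
    \bigcap_(x in setT) \bigcap_(y in setT)
       [set chi | (chi (x * y))^-1 * (chi x * chi y) = 1] `&`
    \bigcap_(x in setT) [set chi : {ptws G -> A} | Z (chi x)]); last first.
  apply/seteqP; split => [chi [chiM chiZ]|chi [chiM chiZ]].
    by split => [x _ y _|x _] //=; rewrite chiM mulVg.
  split => [x y|x]; last exact: chiZ.
  by rewrite -[RHS](mulVKg (chi (x * y))) (chiM x I y I) mulg1.
apply: closedI; last first.
  by apply: closed_bigI => x _; apply: closed_comp => // chi _; exact: ev.
apply: closed_bigI => x _; apply: closed_bigI => y _.
apply: (@closed_comp _ _ (fun chi : {ptws G -> A} =>
  (chi (x * y))^-1 * (chi x * chi y)) [set 1]).
  move=> chi _; apply: continuousMg; last exact: continuousMg.
  exact: continuousVg.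
exact/accessible_closed_set1/hausdorff_accessible.
Qed.

Hypothesis Zcentral : forall z a, Z z -> z * a = a * z.

Lemma quotient_morphism f chi : morphisms_into f -> morphisms_into chi ->
  {morph (fun x => (f x)^-1 * chi x) : x y / x * y}.
Proof.
move=> [fM fZ] [chiM _] x y.
have fyV a : (f y)^-1 * a = a * (f y)^-1.
  by apply: (@mulgI A (f y)); rewrite mulVKg mulgA (Zcentral a (fZ y)) mulgK.
by rewrite fM chiM invgM -mulgA !fyV !mulgA.
Qed.

(** The values of [f^-1 chi] form a subgroup. *)
Lemma uniformly_near_eq f chi V :
    (forall H : set A, is_subgroup H -> H `<=` V -> H = [set 1]) ->
    uniformly_near f setT V chi -> morphisms_into f -> morphisms_into chi ->
  f = chi.
Proof.
move=> Vsub nfchi fZ chiZ.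
have qM := quotient_morphism fZ chiZ.
pose q x := (f x)^-1 * chi x.
have H1 : range q = [set 1].
  apply: Vsub; last by move=> _ [x _ <-]; exact: nfchi.
  split; first by rewrite inE; exists 1 => //; exact: morphism1 qM.
  move=> _ _ /set_mem[x _ <-] /set_mem[y _ <-]; rewrite inE.
  by exists (x * y^-1) => //; rewrite /q qM (morphismV _ qM).
apply/funext => x; have : range q (q x) by exists x.
by rewrite H1 /= /q => e; rewrite -[RHS](mulVKg (f x)) e mulg1.
Qed.

Section NearMorphisms.
Variables (f : G -> A) (K : set G) (V : set A).
Hypotheses (fZ : morphisms_into f) (fc : continuous f).

Definition near_morphisms : set (G -> A) :=
  morphisms_into `&` uniformly_near f K V.

(** The points at which the values are confined to a compact set form a
    subgroup, which contains [K]. *)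
Lemma near_morphisms_bounded (S : set G) :
    compact K -> compact V ->
    S `<=` K -> generated_subgroup S = [set: G] ->
  forall x, exists2 T : set A, compact T &
    forall chi, near_morphisms chi -> T (chi x).
Proof.
move=> cK cV SK Sgen.
pose H := [set x | exists2 T : set A, compact T &
    forall chi, near_morphisms chi -> T (chi x)].
suff HS : generated_subgroup S `<=` H by move=> x; apply: HS; rewrite Sgen.
apply: smallest_sub.
  split; first rewrite inE.
    exists [set 1]; first exact: compact_set1.
    by move=> chi [[chiM _] _] /=; rewrite morphism1.
  move=> x y /set_mem[T cT Tx] /set_mem[T' cT' Ty]; rewrite inE.
  exists [set z.1 * z.2 | z in T `*` [set a^-1 | a in T']].
    by apply: compact_mulg => //; exact: compact_invg.
  move=> chi Cchi; have chiM := Cchi.1.1.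
  exists (chi x, (chi y)^-1) => /=; last by rewrite chiM morphismV.
  by split; [exact: Tx|exists (chi y) => //; exact: Ty].
move=> x /SK Kx; exists [set z.1 * z.2 | z in [set f x] `*` V].
  by apply: compact_mulg => //; exact: compact_set1.
move=> chi [_ chiV]; exists (f x, (f x)^-1 * chi x); last by rewrite /= mulVKg.
by split => //; exact: chiV.
Qed.

Hypotheses (nK : nbhs 1 K) (cV : compact V) (clV : closed V).
Hypothesis Vpow : contains_no_powers V.

(** If the first [n] powers of [x] are in [K], then the first [n] powers of
    [(f x)^-1 * chi x] are in [V], and [nss_powers] applies. *)
Lemma near_morphisms_equicontinuous (N : set A) : nbhs 1 N ->
  exists2 O : set G, nbhs 1 O &
    forall chi x, near_morphisms chi -> O x -> N (chi x).
Proof.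
rewrite -{1}(mulg1 1) => /nbhs_mulg[P [N' [nP nN' PN]]].
have [n nV] := nss_powers cV clV Vpow nN'.
exists (f @^-1` P `&` [set x | forall k, (k <= n)%N -> K (x ^+ k)]).
  apply: filterI; last exact: nbhs1_small_powers.
  by apply: fc; rewrite (morphism1 fZ.1).
move=> chi x [chiZ chiV] [Px Kx].
rewrite -(mulVKg (f x) (chi x)); apply: PN => //; apply: nV => k kn.
rewrite -(morphismX _ _ (quotient_morphism fZ chiZ)).
by apply: chiV; exact: Kx.
Qed.

Lemma near_morphisms_continuous chi : near_morphisms chi -> continuous chi.
Proof.
move=> Cchi; apply: morphism_continuous Cchi.1.1 _ => N nN.
have [O nO ON] := near_morphisms_equicontinuous nN.
by apply: filterS nO => x Ox; exact: ON.
Qed.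

Lemma near_morphisms_compact : hausdorff_space A -> closed Z ->
    (forall x, exists2 T : set A, compact T &
       forall chi, near_morphisms chi -> T (chi x)) ->
  compact (near_morphisms : set {compact-open, G -> A}).
Proof.
move=> hausA clZ bnd.
apply: equicontinuous_morphisms_compact => //.
- by move=> chi [[]].
- exact: near_morphisms_equicontinuous.
- apply: closedI; first exact: morphisms_into_closed.
  rewrite (_ : uniformly_near f K V =
     \bigcap_(x in K) [set chi | V ((f x)^-1 * chi x)]) //.
  apply: closed_bigI => x _.
  apply: (@closed_comp _ _ (fun chi : {ptws G -> A} => (f x)^-1 * chi x) V) => //.
  move=> chi _; apply: continuousMg; first exact: cst_continuous.
  exact: (@proj_continuous G (fun=> A) x).
Qed.

End NearMorphisms.
End Morphisms.

(** * Cohomology with trivial actions as a space of homomorphisms *)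

Section CohomologyTrivial.
Local Open Scope group_scope.
Local Open Scope quotient_scope.
Variables (G R A : topGroupType).
Variables (actGR : G -> R -> R) (actGA : G -> A -> A) (actRA : R -> A -> A).
Variable mu : A -> R.
Hypothesis M : partially_crossed_bimodule actGR actGA actRA mu.
Hypothesis trivGA : forall (g : G) (a : A), actGA g a = a.
Hypothesis trivGR : forall (g : G) (r : R), actGR g r = r.

Definition kernel : set A := [set a | mu a = 1].

(** For [mu z = 1], the partially crossed identity compares conjugation by [z]
    with the action of [1]. *)
Lemma kernel_central z a : kernel z -> z * a = a * z.
Proof.
move=> z1; have pc := pc_bimod_partially_crossed M.
have /(partially_crossedP pc a) : @commutator_subgroup R (mu z).
  rewrite z1 => H [[H1 _] _]; exact/set_mem/H1.
rewrite z1 (act1g (precrossed_topmod (partially_crossed_precrossed pc))) => e.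
by rewrite {2}e mulgVK.
Qed.

Lemma kernel_closed : hausdorff_space R -> closed kernel.
Proof.
move=> hR; apply: (@closed_comp _ _ mu [set 1]).
  by move=> a _; exact: (mu_continuous (bimod_precrossed M)).
exact/accessible_closed_set1/hausdorff_accessible.
Qed.

Local Notation Der := (@Der_c G R A actGR actGA mu).
Local Notation homs := (@morphisms_into G A kernel).

Lemma der_alpha_morphism (x : Der) : homs (der_alpha x).
Proof.
have [xM xmu] := set_mem (svalP x); split => [g h|g].
  by rewrite /der_alpha /= xM trivGA.
by rewrite /kernel /= xmu trivGR mulgV.
Qed.

Lemma der_of_morphism (f : Ck G A) (r : R) : homs f ->
  @der_set G R A actGR actGA mu (f, r).
Proof.
by move=> [fM fZ]; split => [g h|g] /=; rewrite ?trivGA ?fM// trivGR mulgV fZ.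
Qed.

(** Conjugation is trivial by centrality, and the parameter in [R] is free
    because [H0] is all of [R]. *)
Lemma der_simE (x y : Der) :
  der_sim x y <-> (der_alpha x : G -> A) = der_alpha y.
Proof.
have [xM xZ] := der_alpha_morphism x.
split => [[a [e _]]|e].
  apply/funext => g; rewrite e trivGA -mulgA (kernel_central _ (xZ g)).
  by rewrite mulgA mulVg mul1g.
have mu1 : mu 1 = 1.
  by apply: (@mulgI R (mu 1)); rewrite -(muM (bimod_precrossed M)) !mulg1.
exists 1; split => [g|]; first by rewrite trivGA invg1 mul1g mulg1 e.
exists ((der_r x)^-1 * der_r y); first by move=> g; exact: trivGR.
by rewrite mu1 invg1 mul1g mulVKg.
Qed.

Local Notation cls := (\pi_(H1 M) : Der -> H1 M).

Lemma clsE (x y : Der) : cls x = cls y <-> (der_alpha x : G -> A) = der_alpha y.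
Proof.
rewrite -der_simE; split => [/eqmodP/asboolP//|xy].
exact/eqmodP/asboolP.
Qed.

Lemma der_alpha_continuous :
  continuous (fun x : Der => (der_alpha x : G -> A) : {compact-open, G -> A}).
Proof.
move=> x.
apply: (@continuous_comp _ _ _ (fun x : Der => der_alpha x)
   (fun f : Ck G A => (f : G -> A) : {compact-open, G -> A})); last first.
  exact: initial_continuous.
apply: (@continuous_comp _ _ _ (fun x : Der => set_val x) fst).
  exact: initial_continuous.
exact: cvg_fst.
Qed.

Lemma cls_open (U : set (H1 M)) :
    (forall x, U (cls x) -> exists2 W : set {compact-open, G -> A},
      nbhs ((der_alpha x : G -> A) : {compact-open, G -> A}) W &
      forall y, W (der_alpha y) -> U (cls y)) ->
  open U.
Proof.
move=> Uloc; suff : open (cls @^-1` U) by [].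
rewrite openE => x /Uloc[W nW WU].
have nx : nbhs x [set y | W (der_alpha y : G -> A)].
  exact: der_alpha_continuous.
by apply: filterS nx => y; exact: WU.
Qed.

(** The image in [H1] of a compact set of homomorphisms: since the class does not
    depend on the parameter in [R], the derivations with parameter [1] suffice,
    and these form a compact set even when [R] is not compact. *)
Lemma cls_compact (C : set {compact-open, G -> A}) :
    compact C -> (forall chi, C chi -> homs chi /\ continuous chi) ->
  compact (cls @` [set x | C (der_alpha x)]).
Proof.
move=> cC Chc.
pose C1 : set (Ck G A) := [set f | C f].
have cC1 : compact C1.
  apply: compact_initial cC _ => chi Cchi.
  have chic : [set f : {compact-open, G -> A} | continuous (f : G -> A)] chi.
    by have [] := Chc chi Cchi.
  by exists (exist _ chi (mem_set chic)).
pose C2 : set Der := set_val @^-1` (C1 `*` [set 1]).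
have cC2 : compact C2.
  apply: compact_initial.
    by apply: compact_setX => //; exact: compact_set1.
  move=> [f r] [/= Cf _].
  have dfr := @der_of_morphism f r (Chc _ Cf).1.
  by exists (exist _ (f, r) (mem_set dfr)).
suff -> : cls @` [set x | C (der_alpha x)] = cls @` C2.
  apply: continuous_compact cC2; apply: continuous_subspaceT.
  exact: pi_continuous.
apply/seteqP; split => [_ [x Cx <-]|_ [x [Cx _] <-]]; last by exists x.
have d1 := @der_of_morphism (der_alpha x) 1 (der_alpha_morphism x).
exists (exist _ (der_alpha x, 1) (mem_set d1)); first by [].
by apply/clsE.
Qed.

Lemma cls_surj (p : H1 M) : exists x, p = cls x.
Proof. by exists (repr p); rewrite reprK. Qed.

(** The classes of the homomorphisms in an open set form an open set, because the
    derivations in a class all have the same homomorphism. *)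
Lemma cls_nbhs x (W : set {compact-open, G -> A}) :
    nbhs ((der_alpha x : G -> A) : {compact-open, G -> A}) W ->
  nbhs (cls x) (cls @` [set y | W (der_alpha y)]).
Proof.
move=> nW; apply: (@filterS _ _ _ (cls @` [set y | W° (der_alpha y)])).
  by move=> _ [y Wy <-]; exists y => //; exact: (interior_subset Wy).
apply: open_nbhs_nbhs; split; last by exists x.
apply: cls_open => z [y Wy /clsE e]; exists W°.
  by rewrite -e; exact: open_nbhs_nbhs (conj (open_interior W) Wy).
by move=> t Wt; exists t.
Qed.

(** Every class has a compact neighborhood, that of the homomorphisms close to a
    representative on [K]. *)
Lemma k_space_H1 (K : set G) (V : set A) :
    hausdorff_space R -> hausdorff_space A ->
    compact K -> nbhs 1 K -> nbhs 1 V -> compact V -> closed V ->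
    contains_no_powers V ->
    (forall f, continuous f -> forall x, exists2 T : set A, compact T &
       forall chi, near_morphisms kernel f K V chi -> T (chi x)) ->
  k_space (H1 M).
Proof.
move=> hR hA cK nK nV cV clV Vpow bnd; apply: k_space_compact_nbhs => p.
have [x ->] := cls_surj p.
set f : G -> A := der_alpha x.
have fh : homs f := der_alpha_morphism x.
have fc : continuous f := set_mem (svalP (der_alpha x)).
exists (cls @` [set y | near_morphisms kernel f K V (der_alpha y)]).
  apply: cls_compact.
    apply: near_morphisms_compact => //; last exact: bnd.
    - exact: kernel_central.
    - exact: kernel_closed.
  move=> chi Cchi; split; first exact: Cchi.1.
  exact: (near_morphisms_continuous kernel_central fh fc nK cV clV Vpow Cchi).
apply: filterS (cls_nbhs (uniformly_near_nbhs fc cK nV)).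
by apply: image_subset => y nfy; split => //; exact: der_alpha_morphism.
Qed.

Lemma discrete_H1 : compact [set: G] -> no_small_subgroups A ->
  is_discrete (H1 M).
Proof.
move=> cG [V nV Vsub] U; apply: cls_open => x Ux.
have fc : continuous (der_alpha x) := set_mem (svalP (der_alpha x)).
exists (uniformly_near (der_alpha x) [set: G] V).
  exact: uniformly_near_nbhs.
move=> y nxy; suff -> : cls y = cls x by [].
apply/clsE/esym/(uniformly_near_eq kernel_central Vsub nxy);
  exact: der_alpha_morphism.
Qed.

Lemma compact_H1 : hausdorff_space R -> hausdorff_space A ->
  is_discrete G -> compact [set: A] -> compact [set: H1 M].
Proof.
move=> hR hA dG cA.
have nG (g : G) (O : set G) : O g -> nbhs g O.
  by move=> Og; apply: open_nbhs_nbhs; split.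
suff <- : cls @` [set x | homs (der_alpha x)] = [set: H1 M].
  apply: cls_compact; last first.
    by move=> chi chih; split => // g U nU; exact/nG/(nbhs_singleton nU).
  apply: equicontinuous_morphisms_compact.
  - by move=> chi [].
  - move=> N nN; exists [set 1]; first exact: nG.
    by move=> chi g [chiM _] ->; rewrite (morphism1 chiM); exact: nbhs_singleton.
  - by move=> g; exists setT.
  - by apply: morphisms_into_closed => //; exact: kernel_closed.
apply/seteqP; split => // p _; have [x ->] := cls_surj p.
by exists x => //; exact: der_alpha_morphism.
Qed.

End CohomologyTrivial.

Theorem theorem3p6 (G R A : topGroupType)
    (hausG : hausdorff_space G) (hausR : hausdorff_space R)
    (hausA : hausdorff_space A)
    (actGR : G -> R -> R) (actGA : G -> A -> A) (actRA : R -> A -> A)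
    (mu : A -> R)
    (M : partially_crossed_bimodule actGR actGA actRA mu)
    (lcG : locally_compact [set: G])
    (trivGA : forall (g : G) (a : A), actGA g a = a)
    (trivGR : forall (g : G) (r : R), actGR g r = r) :
  [/\ k_group R -> compact [set: A] -> no_small_subgroups A ->
        k_space (H1 M),
      compactly_generated G -> k_group R -> locally_compact [set: A] ->
        no_small_subgroups A -> k_space (H1 M),
      compact [set: G] -> no_small_subgroups A -> is_discrete R ->
        is_discrete (H1 M)
    & finite_set [set: G] -> is_discrete G ->
        finite_set [set: R] -> is_discrete R ->
        compact [set: A] -> no_small_subgroups A ->
        finite_set [set: H1 M] /\ is_discrete (H1 M)].
Proof.
have [K [nK cK _]] := locally_compact_nbhs1 lcG.
split.
- move=> _ cA nssA.
  have lcA : locally_compact [set: A].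
    by move=> a _; exists setT; [exact: filterT|split => //; exact: closedT].
  have [V [nV cV clV Vpow]] := nss_compact_nbhs nssA lcA.
  apply: (k_space_H1 trivGA trivGR hausR hausA cK nK nV cV clV Vpow).
  by move=> f _ x; exists setT.
- move=> [S cS Sgen] _ lcA nssA.
  have [V [nV cV clV Vpow]] := nss_compact_nbhs nssA lcA.
  have cKS : compact (K `|` S) by exact: compactU.
  have nKS : nbhs 1%g (K `|` S) by apply: filterS nK => x; left.
  apply: (k_space_H1 trivGA trivGR hausR hausA cKS nKS nV cV clV Vpow) => f _.
  exact: near_morphisms_bounded cKS cV (@subsetUr _ K S) Sgen.
- by move=> cG nssA _; exact: discrete_H1.
- move=> fG dG _ _ cA nssA.
  have dH : is_discrete (H1 M).
    by apply: discrete_H1 => //; exact: finite_compact.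
  split => //; apply: discrete_compact_finite => //.
  exact: compact_H1.
Qed.
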